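(* Let $K$ be a field of characteristic $0$ and $E=\bigsqcup_{i\ge1}E_i$ a non-empty graded set. Let $\mathcal L'(E)=(\mathcal M_E,\cdot)/J'=\mathcal T^E/I$ and $\mathcal L(E)=(\mathcal M_E,\ast)/J$, each with its pre-Lie structure and its Lie structure as described in the context. Then there is a unique pre-Lie (respectively Lie) isomorphism $\Phi$ from $\mathcal L'(E)$ onto $\mathcal L(E)$ such that $\Phi(a \bmod J')=a\bmod J$ for every $a\in E$.
   Context: $E_i$ is the finite set of generators of degree $i$. $(M(E),\cdot)$ is the free magma on $E$, graded by $|x\cdot y|=|x|+|y|$, and $\mathcal M_E$ is its $K$-linear span, the free magmatic algebra (bilinear product $\cdot$). A second magmatic product is $x\ast y:=|x|\,x\cdot y$ for $x,y\in M(E)$, extended bilinearly. $J$ is the two-sided ideal of $(\mathcal M_E,\ast)$ generated by the anti-symmetry and Jacobi relations $x\ast y+y\ast x$ and $x\ast(y\ast z)+y\ast(z\ast x)+z\ast(x\ast y)$. $J'$ is the two-sided ideal of $(\mathcal M_E,\cdot)$ generated by the pre-Lie relations $x\cdot(y\cdot z)-(x\cdot y)\cdot z-y\cdot(x\cdot z)+(y\cdot x)\cdot z$ and by the elements $|x|\,x\cdot y+|y|\,y\cdot x$, for $x,y,z\in M(E)$. Thus $\mathcal L(E)$ with the bracket $[\cdot,\cdot]$ induced by $\ast$ is the free Lie algebra on $E$; its pre-Lie product is $x\rhd y=\frac1{|x|}[x,y]$ ($x$ homogeneous of degree $|x|$, extended bilinearly). $\mathcal T^E$ is the $K$-linear span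 of the non-planar rooted trees with vertices decorated by $E$; the degree $|t|$ of a tree is the sum of the degrees of its decorations; grafting is $s\to t=\sum_{v\in V(t)}s\to_v t$, where $s\to_v t$ attaches the root of $s$ by a new edge to the vertex $v$ of $t$; $(\mathcal T^E,\to)$ is the free left pre-Lie algebra on $E$, i.e. the quotient of $(\mathcal M_E,\cdot)$ by the ideal generated by the pre-Lie relations. $I$ is the two-sided ideal of $\mathcal T^E$ generated by the elements $|s|(s\to t)+|t|(t\to s)$, for trees $s,t$; it is the image of $J'$, so $\mathcal M_E/J'=\mathcal T^E/I$. The pre-Lie product on $\mathcal L'(E)$ is the one induced by $\to$ (equivalently by $\cdot$), and its Lie bracket is $[\overline s,\overline t]=|s|\,\overline{s\to t}$ for trees $s,t$, where the bar denotes the class modulo $I$. *)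

(* Defs.v *)
(* MathComp, with boolp for the undecidable ideals and monalg for free modules. *)
From HB Require Import structures.
From mathcomp Require Import all_boot all_order all_algebra.
From mathcomp Require Import finmap.
From mathcomp Require Import boolp classical_sets cardinality.
From mathcomp Require Import monalg ring.

Set Implicit Arguments.
Unset Strict Implicit.
Unset Printing Implicit Defensive.

Import GRing.Theory.
Local Open Scope ring_scope.
Local Open Scope quotient_scope.

Inductive magma (E : Type) : Type :=
| mag_gen of E
| mag_mul of magma E & magma E.
Arguments mag_gen {E}.
Arguments mag_mul {E}.

Section MagmaChoice.
Variable E : choiceType.

Fixpoint magma_encode (x : magma E) : GenTree.tree E :=
  match x with
  | mag_gen a => GenTree.Leaf a
  | mag_mul x y => GenTree.Node 0 [:: magma_encode x; magma_encode y]
  end.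

Fixpoint magma_decode (t : GenTree.tree E) : option (magma E) :=
  match t with
  | GenTree.Leaf a => Some (mag_gen a)
  | GenTree.Node _ [:: s; t] =>
      if (magma_decode s, magma_decode t) is (Some x, Some y)
      then Some (mag_mul x y) else None
  | _ => None
  end.

Lemma magma_encodeK : pcancel magma_encode magma_decode.
Proof. by elim=> //= x -> y ->. Qed.

HB.instance Definition _ := Equality.copy (magma E) (pcan_type magma_encodeK).
HB.instance Definition _ := Choice.copy (magma E) (pcan_type magma_encodeK).

End MagmaChoice.

(* |x|, for generators a of degree deg a. *)
Fixpoint mag_deg (E : Type) (deg : E -> nat) (x : magma E) : nat :=
  match x with
  | mag_gen a => deg a
  | mag_mul x y => (mag_deg deg x + mag_deg deg y)%N
  end.

(* Linear extension to K T of a map defined on T; locked because unfolding it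
   makes unification up to conversion very slow. *)
HB.lock Definition linext (K : fieldType) (T : choiceType) (V : lmodType K)
    (f : T -> V) (g : {malg K[T]}) : V :=
  \sum_(k <- msupp g) g@_k *: f k.

Section LinExt.
Variables (K : fieldType) (T : choiceType).

Lemma linextE (V : lmodType K) (f : T -> V) (g : {malg K[T]}) :
  linext f g = \sum_(k <- msupp g) g@_k *: f k.
Proof. by rewrite unlock. Qed.

Lemma linextEw (V : lmodType K) (f : T -> V) (g : {malg K[T]}) (d : {fset T}) :
  (msupp g `<=` d)%fset -> linext f g = \sum_(k <- d) g@_k *: f k.
Proof.
move=> le; rewrite linextE; rewrite (big_fset_incl _ le) // => k _ kg.
by rewrite mcoeff_outdom ?scale0r.
Qed.

Lemma linext_is_linear (V : lmodType K) (f : T -> V) : linear (linext f).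
Proof.
move=> a x y.
pose d := (msupp x `|` msupp y `|` msupp (a *: x + y))%fset.
have dx : (msupp x `<=` d)%fset by rewrite /d -fsetUA fsubsetUl.
have dy : (msupp y `<=` d)%fset.
  exact: fsubset_trans (fsubsetUr _ _) (fsubsetUl _ _).
have dxy : (msupp (a *: x + y) `<=` d)%fset by rewrite /d fsubsetUr.
rewrite (linextEw _ dx) (linextEw _ dy) (linextEw _ dxy).
rewrite scaler_sumr -big_split /=; apply: eq_bigr => k _.
by rewrite mcoeffD mcoeffZ scalerDl scalerA.
Qed.

HB.instance Definition _ (V : lmodType K) (f : T -> V) :=
  GRing.isLinear.Build K {malg K[T]} V *:%R (linext f) (linext_is_linear f).

Lemma linextU (V : lmodType K) (f : T -> V) (k : T) : linext f << k >> = f k.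
Proof.
by rewrite linextE msuppU oner_eq0 big_seq_fset1 mcoeffU eqxx mulr1n scale1r.
Qed.

Lemma malg_span (g : {malg K[T]}) : g = \sum_(k <- msupp g) g@_k *: << k >>.
Proof.
rewrite {1}[g]monalgE; apply: eq_bigr => k _.
by apply/malgP => j; rewrite mcoeffZ !mcoeffU mulr_natr.
Qed.

Lemma malg_lin_ind (P : {malg K[T]} -> Prop) :
  P 0 -> (forall a k g, P g -> P (a *: << k >> + g)) -> forall g, P g.
Proof.
move=> P0 PD g; rewrite [g]malg_span.
elim: (enum_fset (msupp g)) => [|k s IHs]; first by rewrite big_nil.
by rewrite big_cons; apply: PD.
Qed.

End LinExt.

Section AlgQuotient.
Variables (K : fieldType) (V : lmodType K) (op : {bilinear V -> V -> V}).
Variable S : set V.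

(* Two-sided ideal of (V, op) generated by S. *)
Inductive ideal_gen : V -> Prop :=
| ideal_base x of S x : ideal_gen x
| ideal_0 : ideal_gen 0
| ideal_lin a x y of ideal_gen x & ideal_gen y : ideal_gen (a *: x + y)
| ideal_mull x y of ideal_gen y : ideal_gen (op x y)
| ideal_mulr x y of ideal_gen x : ideal_gen (op x y).

Definition ideal_pred : {pred V} := fun x => `[< ideal_gen x >].

Lemma ideal_predP x : reflect (ideal_gen x) (x \in ideal_pred).
Proof. exact: asboolP. Qed.

Lemma ideal_submod_closed : submod_closed ideal_pred.
Proof.
split; first by apply/ideal_predP; exact: ideal_0.
by move=> a x y /ideal_predP hx /ideal_predP hy; apply/ideal_predP/ideal_lin.
Qed.

HB.instance Definition _ :=
  GRing.isSubmodClosed.Build K V ideal_pred ideal_submod_closed.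

Definition alg_quot := Quotient.quot ideal_pred.

HB.instance Definition _ := Choice.on alg_quot.
HB.instance Definition _ := EqQuotient.on alg_quot.
HB.instance Definition _ := GRing.Zmodule.on alg_quot.
HB.instance Definition _ := @isZmodQuotient.Build V
  (Quotient.equiv ideal_pred) 0 -%R +%R alg_quot
  (lock _) (@Quotient.pi_opp V ideal_pred) (@Quotient.pi_add V ideal_pred).

Definition pi_alg (x : V) : alg_quot := \pi_alg_quot x.

Lemma pi_algE x y : (pi_alg x = pi_alg y) <-> ideal_gen (x - y).
Proof.
split; first by move/eqP; rewrite -Quotient.idealrBE => /ideal_predP.
by move=> h; apply/eqP; rewrite -Quotient.idealrBE; apply/ideal_predP.
Qed.

Lemma pi_alg_repr u : pi_alg (repr u) = u. Proof. exact: reprK. Qed.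

Lemma pi_algD : {morph pi_alg : x y / x + y}.
Proof. by move=> x y; rewrite /pi_alg !piE. Qed.

Definition alg_quot_scale (a : K) (u : alg_quot) := pi_alg (a *: repr u).

Lemma idealZ a x : ideal_gen x -> ideal_gen (a *: x).
Proof. by move=> h; rewrite -[_ *: _]addr0; apply: ideal_lin h ideal_0. Qed.

Lemma pi_alg_scale a x : alg_quot_scale a (pi_alg x) = pi_alg (a *: x).
Proof.
by apply/pi_algE; rewrite -scalerBr; apply/idealZ/pi_algE/pi_alg_repr.
Qed.

Fact alg_quot_scaleA a b u :
  alg_quot_scale a (alg_quot_scale b u) = alg_quot_scale (a * b) u.
Proof. by rewrite -[u]pi_alg_repr !pi_alg_scale scalerA. Qed.
Fact alg_quot_scale1 : left_id 1 alg_quot_scale.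
Proof. by move=> u; rewrite -[u]pi_alg_repr !pi_alg_scale scale1r. Qed.
Fact alg_quot_scaleDr : right_distributive alg_quot_scale +%R.
Proof.
move=> a u v; rewrite -[u]pi_alg_repr -[v]pi_alg_repr -pi_algD !pi_alg_scale.
by rewrite scalerDr pi_algD.
Qed.
Fact alg_quot_scaleDl u : {morph alg_quot_scale^~ u : a b / a + b}.
Proof.
by move=> a b /=; rewrite -[u]pi_alg_repr !pi_alg_scale scalerDl pi_algD.
Qed.

HB.instance Definition _ := GRing.Zmodule_isLmodule.Build K alg_quot
  alg_quot_scaleA alg_quot_scale1 alg_quot_scaleDr alg_quot_scaleDl.

Fact pi_alg_is_linear : linear pi_alg.
Proof. by move=> a x y; rewrite pi_algD -pi_alg_scale. Qed.

HB.instance Definition _ :=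
  GRing.isLinear.Build K V alg_quot *:%R pi_alg pi_alg_is_linear.

Lemma pi_alg_ind (P : alg_quot -> Prop) :
  (forall x, P (pi_alg x)) -> forall u, P u.
Proof. by move=> h u; rewrite -[u]pi_alg_repr. Qed.

(* Computing on representatives is legitimate: see pi_quot_op. *)
Definition quot_op (u v : alg_quot) : alg_quot := pi_alg (op (repr u) (repr v)).

Lemma pi_quot_op x y : quot_op (pi_alg x) (pi_alg y) = pi_alg (op x y).
Proof.
have hrepr z : ideal_gen (repr (pi_alg z) - z) by apply/pi_algE/pi_alg_repr.
set x' := repr (pi_alg x); set y' := repr (pi_alg y).
transitivity (pi_alg (op x' y)); apply/pi_algE.
- by rewrite -linearBr; apply/ideal_mull/hrepr.
- by rewrite -linearBl; apply/ideal_mulr/hrepr.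
Qed.

Lemma ideal_pi0 x : S x -> pi_alg x = 0.
Proof.
by move=> Sx; rewrite -[RHS](linear0 pi_alg); apply/pi_algE/ideal_base; rewrite subr0.
Qed.

Lemma quot_op_anti a b x y :
  a *: quot_op (pi_alg x) (pi_alg y) + b *: quot_op (pi_alg y) (pi_alg x) =
  pi_alg (a *: op x y + b *: op y x).
Proof. by rewrite !pi_quot_op linearP linearZ. Qed.

Lemma quot_op_Jacobi x y z (x' := pi_alg x) (y' := pi_alg y) (z' := pi_alg z) :
  quot_op x' (quot_op y' z') + quot_op y' (quot_op z' x')
    + quot_op z' (quot_op x' y') =
  pi_alg (op x (op y z) + op y (op z x) + op z (op x y)).
Proof. by rewrite /x' /y' /z' !pi_quot_op !linearD. Qed.

Lemma quot_op_preLie x y z (x' := pi_alg x) (y' := pi_alg y) (z' := pi_alg z) :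
  quot_op x' (quot_op y' z') - quot_op (quot_op x' y') z'
    - quot_op y' (quot_op x' z') + quot_op (quot_op y' x') z' =
  pi_alg (op x (op y z) - op (op x y) z - op y (op x z) + op (op y x) z).
Proof. by rewrite /x' /y' /z' !pi_quot_op linearD !linearB. Qed.

Fact quot_op_is_bilinear : bilinear_for *:%R *:%R quot_op.
Proof.
split=> u' a u v /=.
  elim/pi_alg_ind: u' => z; elim/pi_alg_ind: u => x; elim/pi_alg_ind: v => y.
  by rewrite -linearP !pi_quot_op linearPl linearP.
elim/pi_alg_ind: u' => z; elim/pi_alg_ind: u => x; elim/pi_alg_ind: v => y.
by rewrite -linearP !pi_quot_op linearPr linearP.
Qed.

HB.instance Definition _ := bilinear_isBilinear.Build K alg_quot alg_quot
  alg_quot *:%R *:%R quot_op quot_op_is_bilinear.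

Section QuotMap.
Variable D : {linear V -> V}.
Hypothesis D_ideal : forall x, ideal_gen x -> ideal_gen (D x).

(* Meaningful when D preserves the ideal: see pi_quot_map. *)
Definition quot_map (u : alg_quot) : alg_quot := pi_alg (D (repr u)).

Lemma pi_quot_map x : quot_map (pi_alg x) = pi_alg (D x).
Proof.
by apply/pi_algE; rewrite -linearB; apply/D_ideal/pi_algE/pi_alg_repr.
Qed.

Fact quot_map_is_linear : linear quot_map.
Proof.
move=> a u v; elim/pi_alg_ind: u => x; elim/pi_alg_ind: v => y.
by rewrite -linearP !pi_quot_map !linearP.
Qed.

Fact quot_map_op_bilinear :
  bilinear_for *:%R *:%R (fun u v => quot_op (quot_map u) v).
Proof.
split=> w a u v /=; last by rewrite linearPr.
by rewrite quot_map_is_linear linearPl.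
Qed.

End QuotMap.

End AlgQuotient.

Section Structures.
Variables (K : fieldType).

(* Left pre-Lie identity: the associator is symmetric in x and y. *)
Definition is_preLie (A : lmodType K) (op : {bilinear A -> A -> A}) : Prop :=
  forall x y z, op x (op y z) - op (op x y) z = op y (op x z) - op (op y x) z.

Definition is_Lie (A : lmodType K) (op : {bilinear A -> A -> A}) : Prop :=
  (forall x, op x x = 0) /\
  (forall x y z, op x (op y z) + op y (op z x) + op z (op x y) = 0).

Definition alg_iso (A B : lmodType K) (opA : {bilinear A -> A -> A})
    (opB : {bilinear B -> B -> B}) (f : A -> B) : Prop :=
  [/\ linear f, bijective f & {morph f : x y / opA x y >-> opB x y}].

End Structures.

Lemma scaler_swap (K : fieldType) (A : lmodType K) (a b : K) (u : A) :
  a *: (b *: u) = b *: (a *: u).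
Proof. by rewrite !scalerA mulrC. Qed.

Section LieIdentities.
Variables (K : fieldType) (A : lmodType K) (op : {bilinear A -> A -> A}).

Lemma Lie_anti : is_Lie op -> forall x y, op y x = - op x y.
Proof.
case=> alt _ x y; apply/eqP; rewrite -addr_eq0 addrC; apply/eqP.
by have := alt (x + y); rewrite linearDl !linearDr !alt add0r addr0.
Qed.

Lemma preLie_of_Lie (a b : K) x y z : is_Lie op ->
  a != 0 -> b != 0 -> a + b != 0 ->
  a^-1 *: op x (b^-1 *: op y z) - a^-1 *: ((a + b)^-1 *: op (op x y) z) =
  b^-1 *: op y (a^-1 *: op x z) - b^-1 *: ((a + b)^-1 *: op (op y x) z).
Proof.
move=> opL a0 b0 ab0; have anti := Lie_anti opL; rewrite !linearZr_LR /=.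
have -> : op x (op y z) = op y (op x z) + op (op x y) z.
  have := opL.2 x y z.
  rewrite [op z x]anti linearNr [op z _]anti -addrA -opprD => /eqP.
  by rewrite subr_eq0 => /eqP.
rewrite [op y x]anti linearNl !scalerN opprK !scalerA.
rewrite scalerDr [b^-1 * _]mulrC -addrA; congr (_ + _).
by rewrite -scalerBl; congr (_ *: _); field; rewrite a0 b0 ab0.
Qed.

Lemma preLie_of_Lie_scaled (pop : {bilinear A -> A -> A}) (a b : K) x y z :
  is_Lie op -> a != 0 -> b != 0 -> a + b != 0 ->
  (forall v, pop x v = a^-1 *: op x v) -> (forall v, pop y v = b^-1 *: op y v) ->
  (forall v, pop (op x y) v = (a + b)^-1 *: op (op x y) v) ->
  pop x (pop y z) - pop (pop x y) z = pop y (pop x z) - pop (pop y x) z.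
Proof.
move=> opL a0 b0 ab0 hx hy hxy.
have hyx v : pop (op y x) v = (a + b)^-1 *: op (op y x) v.
  by rewrite (Lie_anti opL x y) !linearNl hxy scalerN.
rewrite !hx !hy !linearZl_LR /= hxy hyx; exact: preLie_of_Lie.
Qed.

Lemma Jacobi_of_preLie (a b c : K) x y z : is_preLie op ->
  a *: op x y + b *: op y x = 0 -> a *: op x z + c *: op z x = 0 ->
  (a + b) *: op (op x y) z + c *: op z (op x y) = 0 ->
  a *: op x (b *: op y z) + b *: op y (c *: op z x) + c *: op z (a *: op x y) = 0.
Proof.
move=> opP hxy hxz hxyz.
have -> : c *: op z x = - (a *: op x z) by apply/eqP; rewrite -addr_eq0 addrC hxz.
have -> : c *: op z (a *: op x y) = - (a *: ((a + b) *: op (op x y) z)).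
  rewrite linearZr_LR /= [LHS]scaler_swap -scalerN; congr (_ *: _).
  by apply/eqP; rewrite -addr_eq0 addrC hxyz.
have e : b *: op (op y x) z = - (a *: op (op x y) z).
  have : b *: op y x = - (a *: op x y).
    by apply/eqP; rewrite -addr_eq0 addrC hxy.
  by move/(congr1 (op^~ z)); rewrite /= linearNl !linearZl_LR.
have /eqP := opP x y z; rewrite subr_eq => /eqP h.
rewrite linearNr !linearZr_LR h scalerN [b *: (a *: _)]scaler_swap.
rewrite !scalerDr scalerN e opprK scalerDl scalerDr.
by rewrite -[X in X - _ - _]addrA [X in X - _]addrAC subrr add0r subrr.
Qed.

End LieIdentities.

Section SpanningSet.
Variables (K : fieldType) (A : lmodType K) (op : {bilinear A -> A -> A}).
Variable G : A -> Prop.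
Hypothesis spanG : forall P : A -> Prop, P 0 ->
  (forall a g u, G g -> P u -> P (a *: g + u)) -> forall u, P u.

Lemma span_linear0 (f : A -> A) : linear f -> (forall g, G g -> f g = 0) ->
  forall u, f u = 0.
Proof.
move=> f_lin f0; apply: spanG => [|a g u Gg fu].
  by have := f_lin (-1) 0 0; rewrite scaler0 addr0 scaleN1r addNr.
by rewrite f_lin f0 // fu scaler0 addr0.
Qed.

Lemma linP_sub a (x x' y y' : A) :
  (a *: x + x') - (a *: y + y') = a *: (x - y) + (x' - y').
Proof. by rewrite opprD addrACA scalerBr. Qed.

Lemma linP_add a (x x' y y' : A) :
  (a *: x + x') + (a *: y + y') = a *: (x + y) + (x' + y').
Proof. by rewrite addrACA scalerDr. Qed.

Lemma span_preLie :
  (forall x y z, G x -> G y -> G z ->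
     op x (op y z) - op (op x y) z = op y (op x z) - op (op y x) z) ->
  is_preLie op.
Proof.
move=> h x y z; apply/eqP; rewrite -subr_eq0; apply/eqP.
move: x; apply: span_linear0 => [a u v|x Gx].
  by rewrite !(linearPl, linearPr) /= ?(linearPl, linearPr) /= ?(linearPl, linearPr) /= !linP_sub.
move: y; apply: span_linear0 => [a u v|y Gy].
  by rewrite !(linearPl, linearPr) /= ?(linearPl, linearPr) /= ?(linearPl, linearPr) /= !linP_sub.
move: z; apply: span_linear0 => [a u v|z Gz].
  by rewrite !(linearPl, linearPr) /= ?(linearPl, linearPr) /= ?(linearPl, linearPr) /= !linP_sub.
by rewrite h // subrr.
Qed.

Lemma span_anti : (forall x y, G x -> G y -> op x y + op y x = 0) ->
  forall x y, op x y + op y x = 0.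
Proof.
move=> h x y; move: x; apply: span_linear0 => [a u v|x Gx].
  by rewrite !(linearPl, linearPr) /= linP_add.
move: y; apply: span_linear0 => [a u v|y Gy].
  by rewrite !(linearPl, linearPr) /= linP_add.
exact: h.
Qed.

Lemma span_Lie : 2%:R != 0 :> K ->
  (forall x y, G x -> G y -> op x y + op y x = 0) ->
  (forall x y z, G x -> G y -> G z ->
     op x (op y z) + op y (op z x) + op z (op x y) = 0) ->
  is_Lie op.
Proof.
move=> K2 /span_anti anti h; split=> [x|x y z].
  apply/eqP; have /eqP := anti x x.
  by rewrite -mulr2n -scaler_nat scaler_eq0 (negPf K2).
move: x; apply: span_linear0 => [a u v|x Gx].
  by rewrite !(linearPl, linearPr) /= ?(linearPl, linearPr) /= ?(linearPl, linearPr) /= !linP_add.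
move: y; apply: span_linear0 => [a u v|y Gy].
  by rewrite !(linearPl, linearPr) /= ?(linearPl, linearPr) /= ?(linearPl, linearPr) /= !linP_add.
move: z; apply: span_linear0 => [a u v|z Gz].
  by rewrite !(linearPl, linearPr) /= ?(linearPl, linearPr) /= ?(linearPl, linearPr) /= !linP_add.
exact: h.
Qed.

End SpanningSet.

Section FreeMagmatic.
Variables (K : fieldType) (E : choiceType) (deg : E -> nat).
Local Notation M := (magma E).
Local Notation ME := {malg K[M]}.

Definition wt (x : M) : K := (mag_deg deg x)%:R.

(* Bilinear extension of a map defined on pairs of monomials. *)
Definition bilext (f : M -> M -> ME) (x y : ME) : ME :=
  linext (fun m => linext (f m) y) x.

Fact bilext_linearl f z : linear (bilext f ^~ z).
Proof. by move=> a x y; rewrite /bilext linearP. Qed.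

Fact bilext_linearr f z : linear (bilext f z).
Proof.
move=> a x y; rewrite /bilext !(linextE _ z) scaler_sumr -big_split /=.
by apply: eq_bigr => k _; rewrite linearP /= scalerDr !scalerA mulrC.
Qed.

Fact bilext_is_bilinear f : bilinear_for *:%R *:%R (bilext f).
Proof. by split=> z; [exact: bilext_linearl | exact: bilext_linearr]. Qed.

HB.instance Definition _ f := bilinear_isBilinear.Build K ME ME ME
  *:%R *:%R (bilext f) (bilext_is_bilinear f).

Lemma bilextU f m n : bilext f << m >> << n >> = f m n.
Proof. by rewrite /bilext !linextU. Qed.

Definition dot : ME -> ME -> ME := bilext (fun x y => << mag_mul x y >>).
HB.instance Definition _ := Bilinear.on dot.

Definition star : ME -> ME -> ME :=
  bilext (fun x y => wt x *: << mag_mul x y >>).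
HB.instance Definition _ := Bilinear.on star.

(* Multiplication by c n in each degree n. *)
Definition degscale (c : nat -> K) : ME -> ME :=
  linext (fun x => c (mag_deg deg x) *: << x >>).
HB.instance Definition _ c := GRing.Linear.on (degscale c).

(* By bilinearity it is enough to impose the relations on monomials. *)
Definition lie_rel : set ME := [set r |
  (exists x y : M, r = star << x >> << y >> + star << y >> << x >>) \/
  (exists x y z : M,
     r = star << x >> (star << y >> << z >>)
         + star << y >> (star << z >> << x >>)
         + star << z >> (star << x >> << y >>))].

Definition prelie_rel : set ME := [set r |
  (exists x y z : M,
     r = dot << x >> (dot << y >> << z >>) - dot (dot << x >> << y >>) << z >>
         - dot << y >> (dot << x >> << z >>) + dot (dot << y >> << x >>) << z >>) \/
  (exists x y : M,
     r = wt x *: dot << x >> << y >> + wt y *: dot << y >> << x >>)].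

Lemma dotU m n : dot << m >> << n >> = << mag_mul m n >>.
Proof. exact: bilextU. Qed.

Lemma starU m n : star << m >> << n >> = wt m *: << mag_mul m n >>.
Proof. exact: bilextU. Qed.

Lemma degscaleU c m : degscale c << m >> = c (mag_deg deg m) *: << m >>.
Proof. exact: linextU. Qed.

Lemma degscaleP c a x y :
  degscale c (a *: x + y) = a *: degscale c x + degscale c y.
Proof. exact: linearP. Qed.

Lemma degscaleZ c a x : degscale c (a *: x) = a *: degscale c x.
Proof. exact: linearZ. Qed.

Definition homog n (x : ME) := forall c, degscale c x = c n *: x.

Lemma homogU m : homog (mag_deg deg m) << m >>.
Proof. by move=> c; rewrite degscaleU. Qed.

Lemma homogP n a x y : homog n x -> homog n y -> homog n (a *: x + y).
Proof. by move=> hx hy c; rewrite degscaleP hx hy scalerDr (scaler_swap a). Qed.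

Lemma homogD n x y : homog n x -> homog n y -> homog n (x + y).
Proof. by move=> hx hy; rewrite -[x]scale1r; apply: homogP. Qed.

Lemma homogZ n a x : homog n x -> homog n (a *: x).
Proof. by move=> hx c; rewrite degscaleZ hx (scaler_swap a). Qed.

Lemma homogN n x : homog n x -> homog n (- x).
Proof. by move=> hx; rewrite -scaleN1r; apply: homogZ. Qed.

Section Graded.
Variable op : {bilinear ME -> ME -> ME}.
Variable S : set ME.
Hypothesis opU : forall c m n, degscale c (op << m >> << n >>) =
  c (mag_deg deg m + mag_deg deg n)%N *: op << m >> << n >>.
Hypothesis Shom : forall x, S x -> exists n, homog n x.

Lemma degscale_opl c x n : degscale c (op x << n >>) =
  op (degscale (fun k => c (k + mag_deg deg n)%N) x) << n >>.
Proof.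
elim/malg_lin_ind: x => [|a k g IH]; first by rewrite !(linear0, linear0l).
by rewrite linearPl !linearP /= linearPl IH opU degscaleU linearZl_LR.
Qed.

Lemma degscale_opr c x n : degscale c (op << n >> x) =
  op << n >> (degscale (fun k => c (mag_deg deg n + k)%N) x).
Proof.
elim/malg_lin_ind: x => [|a k g IH]; first by rewrite !(linear0, linear0r).
by rewrite linearPr !linearP /= IH opU degscaleU linearZr_LR.
Qed.

Lemma homog_opl n m x : homog n x ->
  homog (n + mag_deg deg m)%N (op x << m >>).
Proof. by move=> hx c; rewrite degscale_opl hx linearZl_LR. Qed.

Lemma homog_opr n m x : homog n x ->
  homog (mag_deg deg m + n)%N (op << m >> x).
Proof. by move=> hx c; rewrite degscale_opr hx linearZr_LR. Qed.

Lemma ideal_degscale c x : ideal_gen op S x -> ideal_gen op S (degscale c x).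
Proof.
move=> Sx; elim: Sx c => {x} [x Sx c||a x y _ IHx _ IHy c|x y _ IH c|x y _ IH c].
- by have [n ->] := Shom Sx; apply/idealZ/ideal_base.
- by move=> c; rewrite linear0; apply: ideal_0.
- by rewrite linearP; apply: ideal_lin; [exact: IHx | exact: IHy].
- move: x; apply: malg_lin_ind => [|a k g IHg].
    by rewrite linear0l linear0; apply: ideal_0.
  by rewrite linearPl linearP /= degscale_opr; apply/ideal_lin/IHg/ideal_mull/IH.
- move: y; apply: malg_lin_ind => [|a k g IHg].
    by rewrite linear0r linear0; apply: ideal_0.
  by rewrite linearPr linearP /= degscale_opl; apply/ideal_lin/IHg/ideal_mulr/IH.
Qed.

Lemma alg_quot_span (P : alg_quot op S -> Prop) : P 0 ->
  (forall a g u, (exists m, g = pi_alg op S << m >>) -> P u -> P (a *: g + u)) ->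
  forall u, P u.
Proof.
move=> P0 PD; apply: pi_alg_ind.
apply: malg_lin_ind => [|a k g IH]; first by rewrite linear0.
by rewrite linearP; apply: PD => //; exists k.
Qed.

End Graded.

Fact dot_deg c m n : degscale c (dot << m >> << n >>) =
  c (mag_deg deg m + mag_deg deg n)%N *: dot << m >> << n >>.
Proof. by rewrite dotU degscaleU. Qed.

Fact star_deg c m n : degscale c (star << m >> << n >>) =
  c (mag_deg deg m + mag_deg deg n)%N *: star << m >> << n >>.
Proof. by rewrite starU degscaleZ degscaleU (scaler_swap (wt m)). Qed.

Fact lie_rel_hom x : lie_rel x -> exists n, homog n x.
Proof.
have hU := homogU; have hl := @homog_opl _ star_deg.
have hr := @homog_opr _ star_deg.
case=> [[y [z ->]]|[y [z [t ->]]]].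
  exists (mag_deg deg y + mag_deg deg z)%N; apply: homogD; first exact: hl.
  by rewrite addnC; apply: hl.
exists (mag_deg deg y + (mag_deg deg z + mag_deg deg t))%N.
apply: homogD; [apply: homogD|].
- by apply/hr/hr.
- by rewrite addnCA [X in (_ + X)%N]addnC; apply/hr/hr.
- by rewrite addnA addnC; apply/hr/hr.
Qed.

Fact prelie_rel_hom x : prelie_rel x -> exists n, homog n x.
Proof.
have hU := homogU; have hl := @homog_opl _ dot_deg.
have hr := @homog_opr _ dot_deg.
case=> [[y [z [t ->]]]|[y [z ->]]].
  exists (mag_deg deg y + (mag_deg deg z + mag_deg deg t))%N.
  apply: homogD; [apply: homogD; [apply: homogD|]|].
  - by apply/hr/hr.
  - by apply: homogN; rewrite addnA; apply/hl/hl.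
  - by apply: homogN; rewrite addnCA; apply/hr/hr.
  - by rewrite addnA [X in (X + _)%N]addnC; apply/hl/hl.
exists (mag_deg deg y + mag_deg deg z)%N; apply: homogD; apply: homogZ.
  exact: hl.
by rewrite addnC; apply: hl.
Qed.

(* calL = (M_E, star) / J and calL' = (M_E, dot) / J'. *)
Definition calL : lmodType K := alg_quot star lie_rel.
Definition calL' : lmodType K := alg_quot dot prelie_rel.

Definition lie_L : calL -> calL -> calL := quot_op (op := star) (S := lie_rel).
HB.instance Definition _ := Bilinear.on lie_L.

(* x |> y = |x|^-1 [x, y] for x homogeneous (prelie_L_homog); quot_map applies
   the factor |x|^-1 to the homogeneous components of the left argument. *)
Definition prelie_L (u v : calL) : calL :=
  lie_L (quot_map (degscale (fun n => n%:R^-1)) u) v.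
HB.instance Definition _ := bilinear_isBilinear.Build K calL calL calL
  *:%R *:%R prelie_L
  (quot_map_op_bilinear (ideal_degscale star_deg lie_rel_hom (fun n => n%:R^-1))).

Definition prelie_L' : calL' -> calL' -> calL' := quot_op (op := dot) (S := prelie_rel).
HB.instance Definition _ := Bilinear.on prelie_L'.

(* [x, y] = |x| (x . y) for x homogeneous (lie_L'_homog). *)
Definition lie_L' (u v : calL') : calL' :=
  prelie_L' (quot_map (degscale (fun n => n%:R)) u) v.
HB.instance Definition _ := bilinear_isBilinear.Build K calL' calL' calL'
  *:%R *:%R lie_L'
  (quot_map_op_bilinear (ideal_degscale dot_deg prelie_rel_hom (fun n => n%:R))).


Definition piL : ME -> calL := pi_alg star lie_rel.
HB.instance Definition _ := GRing.Linear.on piL.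
Definition piL' : ME -> calL' := pi_alg dot prelie_rel.
HB.instance Definition _ := GRing.Linear.on piL'.

Lemma lie_LE x y : lie_L (piL x) (piL y) = piL (star x y).
Proof. exact: pi_quot_op. Qed.

Lemma prelie_L'E x y : prelie_L' (piL' x) (piL' y) = piL' (dot x y).
Proof. exact: pi_quot_op. Qed.

Lemma piL_span (P : calL -> Prop) : P 0 ->
  (forall a g u, (exists m, g = piL << m >>) -> P u -> P (a *: g + u)) ->
  forall u, P u.
Proof. exact: alg_quot_span. Qed.

Lemma piL'_span (P : calL' -> Prop) : P 0 ->
  (forall a g u, (exists m, g = piL' << m >>) -> P u -> P (a *: g + u)) ->
  forall u, P u.
Proof. exact: alg_quot_span. Qed.

Lemma prelie_L_homog n x v : homog n x ->
  prelie_L (piL x) v = n%:R^-1 *: lie_L (piL x) v.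
Proof.
move=> hx; rewrite -linearZl_LR -linearZ -(hx (fun n => n%:R^-1)) /prelie_L; congr lie_L.
by apply: pi_quot_map; apply: ideal_degscale; [exact: star_deg | exact: lie_rel_hom].
Qed.

Lemma lie_L'_homog n x v : homog n x ->
  lie_L' (piL' x) v = n%:R *: prelie_L' (piL' x) v.
Proof.
move=> hx; rewrite -linearZl_LR -linearZ -(hx (fun n => n%:R)) /lie_L'; congr prelie_L'.
by apply: pi_quot_map; apply: ideal_degscale; [exact: dot_deg | exact: prelie_rel_hom].
Qed.

Lemma lie_L_is_Lie : 2%:R != 0 :> K -> is_Lie lie_L.
Proof.
move=> K2; apply: (span_Lie piL_span) => //.
  move=> _ _ [x ->] [y ->]; rewrite -[X in X + _]scale1r -[X in _ + X]scale1r.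
  apply: etrans (quot_op_anti _ _ _ _ _ _) _; apply: ideal_pi0; left.
  by exists x, y; rewrite !scale1r.
move=> _ _ _ [x ->] [y ->] [z ->].
apply: etrans (quot_op_Jacobi _ _ _ _ _) _; apply: ideal_pi0; right.
by exists x, y, z.
Qed.

Lemma prelie_L_is_preLie : [pchar K] =i pred0 -> (forall a, 0 < deg a)%N ->
  is_preLie prelie_L.
Proof.
move=> /pcharf0P K0 deg0.
have mag_deg_gt0 m : (0 < mag_deg deg m)%N.
  by elim: m => //= m Hm n _; rewrite addn_gt0 Hm.
have wt0 m : wt m != 0 by rewrite /wt K0 -lt0n.
have K2 : 2%:R != 0 :> K by rewrite K0.
apply: (span_preLie piL_span) => _ _ _ [x ->] [y ->] [z ->].
apply: (preLie_of_Lie_scaled (op := lie_L) (a := wt x) (b := wt y)) => //.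
- exact: lie_L_is_Lie.
- by rewrite /wt -natrD K0 -lt0n addn_gt0 mag_deg_gt0.
- by move=> v; apply/prelie_L_homog/homogU.
- by move=> v; apply/prelie_L_homog/homogU.
move=> v; rewrite /= (lie_LE << x >> << y >>) /wt -natrD.
exact/prelie_L_homog/(homog_opl star_deg)/homogU.
Qed.

Lemma prelie_L'_is_preLie : is_preLie prelie_L'.
Proof.
apply: (span_preLie piL'_span) => _ _ _ [x ->] [y ->] [z ->].
apply/eqP; rewrite -subr_eq0 opprB addrA addrAC; apply/eqP.
apply: etrans (quot_op_preLie _ _ _ _ _) _; apply: ideal_pi0; left.
by exists x, y, z.
Qed.

Lemma lie_L'_is_Lie : 2%:R != 0 :> K -> is_Lie lie_L'.
Proof.
move=> K2.
have hE m v : lie_L' (piL' << m >>) v = wt m *: prelie_L' (piL' << m >>) v.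
  exact/lie_L'_homog/homogU.
have anti m n : wt m *: prelie_L' (piL' << m >>) (piL' << n >>)
    + wt n *: prelie_L' (piL' << n >>) (piL' << m >>) = 0.
  apply: etrans (quot_op_anti _ _ _ _ _ _) _; apply: ideal_pi0; right.
  by exists m, n.
apply: (span_Lie piL'_span) => //.
  by move=> _ _ [x ->] [y ->]; apply: etrans (anti x y); congr (_ + _); apply: hE.
move=> _ _ _ [x ->] [y ->] [z ->].
have := anti (mag_mul x y) z.
rewrite -dotU -(prelie_L'E << x >> << y >>) {1}/wt /= natrD => hxyz.
have := Jacobi_of_preLie prelie_L'_is_preLie (anti x y) (anti x z) hxyz.
apply: etrans; congr (_ + _ + _); rewrite /= hE; congr (_ *: _);
  congr prelie_L'; exact: hE.
Qed.

End FreeMagmatic.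

(* Main.v *)
Require Import Defs.
From HB Require Import structures.
From mathcomp Require Import all_boot all_order all_algebra.
From mathcomp Require Import finmap.
From mathcomp Require Import boolp classical_sets cardinality.
From mathcomp Require Import monalg.

Set Implicit Arguments.
Unset Strict Implicit.
Unset Printing Implicit Defensive.

Import GRing.Theory.
Local Open Scope classical_set_scope.
Local Open Scope ring_scope.

(** The two ideals coincide, [J = J'], and [Phi] is induced by the identity of
    the free magmatic algebra.

    - The bracket [lie_L'] of [calL'] is the image of [star] ([lie_L'_piL']),
      and it is a Lie bracket ([lie_L'_is_Lie]).  So [piL'] is a morphism from
      [star] to a Lie bracket; it kills antisymmetry and Jacobi, hence all of
      [J] ([piL'_lie_ideal]).
    - The product [prelie_L] of [calL] is the image of [dot] ([prelie_L_piL]),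
      because the factors [|x|] and [1/|x|] cancel; characteristic 0 and
      positive degrees enter here.  As it is pre-Lie ([prelie_L_is_preLie]),
      [piL] kills the pre-Lie relations.  The other generators of [J'] are
      [|x| x . y + |y| y . x], which is the antisymmetry relation of [star]
      written with [dot].  Hence [piL] kills [J'] ([piL_prelie_ideal]).

    The pre-Lie and the Lie claims are two instances of [unique_iso]: if the
    product of the classes of monomials [x] and [y] is [c x] times the class of
    [x . y] in both quotients, with [c x] nonzero, then [Phi] is multiplicative
    because it preserves classes of monomials, and it is the only such map
    because the images of the generators determine, by induction on the
    monomial, the image of every monomial.  The scalar [c x] is [1] for the
    pre-Lie products and [|x|] for the Lie brackets. *)

(** The universal property of the quotient by a generated ideal. *)
Lemma ideal_gen_kernel (K : fieldType) (V B : lmodType K)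
    (op : {bilinear V -> V -> V}) (S : set V) (opB : {bilinear B -> B -> B})
    (f : {linear V -> B}) :
  {morph f : x y / op x y >-> opB x y} -> (forall x, S x -> f x = 0) ->
  forall x, ideal_gen op S x -> f x = 0.
Proof.
move=> fM fS x; elim=> {x} [x /fS //||a x y _ fx _ fy|x y _ fy|x y _ fx].
- exact: linear0.
- by rewrite linearP fx fy scaler0 addr0.
- by rewrite fM fy linear0r.
- by rewrite fM fx linear0l.
Qed.

(** A bilinear identity is checked on a basis.  The map [p] serves to apply
    this to a quotient of a free module, where there is no basis at hand. *)
Lemma malg_morph (K : fieldType) (T : choiceType) (A B : lmodType K)
    (opA : {bilinear A -> A -> A}) (opB : {bilinear B -> B -> B})
    (p : {linear {malg K[T]} -> A}) (f : {linear A -> B}) :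
  (forall m n, f (opA (p << m >>) (p << n >>)) =
     opB (f (p << m >>)) (f (p << n >>))) ->
  forall x y, f (opA (p x) (p y)) = opB (f (p x)) (f (p y)).
Proof.
move=> fU x y; elim/malg_lin_ind: x => [|a m x IHx].
  by rewrite !(linear0, linear0l).
rewrite !linearP /= !linearPl linearP /= IHx; congr (_ *: _ + _) => {x IHx}.
elim/malg_lin_ind: y => [|b n y IHy]; first by rewrite !(linear0, linear0r).
by rewrite !linearP /= IHy fU.
Qed.

Section Isomorphism.
Variables (K : fieldType) (E : choiceType) (deg : E -> nat).
Hypothesis char0 : [pchar K] =i pred0.
Hypothesis deg_gt0 : forall a : E, (0 < deg a)%N.
Local Notation piL := (@piL K E deg).
Local Notation piL' := (@piL' K E deg).
Local Notation wt := (wt K deg).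

Lemma natr_neq0 n : (0 < n)%N -> n%:R != 0 :> K.
Proof. by move/pcharf0P: char0 => ->; rewrite -lt0n. Qed.

Lemma wt_neq0 m : wt m != 0.
Proof.
apply: natr_neq0; elim: m => [a|m Hm n _] /=; first exact: deg_gt0.
by rewrite addn_gt0 Hm.
Qed.

Lemma prelie_L_piL x y : piL (dot x y) = prelie_L (piL x) (piL y).
Proof.
apply: (malg_morph (p := idfun)) x y => m n /=.
rewrite [RHS](prelie_L_homog _ (homogU (K := K) deg m)).
by rewrite lie_LE starU dotU linearZ scalerA mulVf ?scale1r ?wt_neq0.
Qed.

Lemma lie_L'_piL' x y : piL' (star deg x y) = lie_L' (piL' x) (piL' y).
Proof.
apply: (malg_morph (p := idfun)) x y => m n /=.
rewrite [RHS](lie_L'_homog _ (homogU (K := K) deg m)).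
by rewrite prelie_L'E starU dotU linearZ.
Qed.

(** Makes [Phi] injective: [J] is contained in [J'], since [piL'] turns [star]
    into a Lie bracket. *)
Lemma piL'_lie_ideal x : ideal_gen (star deg) (lie_rel deg) x -> piL' x = 0.
Proof.
have L'Lie : is_Lie (@lie_L' K E deg) by apply/lie_L'_is_Lie/natr_neq0.
move: x; apply: (ideal_gen_kernel (opB := @lie_L' K E deg)) => [|x].
  exact: lie_L'_piL'.
case=> [[m [n ->]]|[m [n [p ->]]]]; rewrite !linearD /= !lie_L'_piL'.
  by rewrite [X in _ + X](Lie_anti L'Lie) subrr.
exact: L'Lie.2.
Qed.

(** Makes [Phi] well defined: [J'] is contained in [J], since [piL] turns [dot]
    into a pre-Lie product. *)
Lemma piL_prelie_ideal x : ideal_gen (@dot K E) (prelie_rel deg) x -> piL x = 0.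
Proof.
move: x; apply: (ideal_gen_kernel (opB := @prelie_L K E deg)) => [|x].
  exact: prelie_L_piL.
case=> [[m [n [p ->]]]|[m [n ->]]].
  rewrite linearD !linearB /= !prelie_L_piL.
  apply/eqP; rewrite -addrA [- _ + _]addrC -[X in _ + X]opprB subr_eq0.
  exact/eqP/prelie_L_is_preLie.
have dot_star k l : wt k *: dot << k >> << l >> = star deg << k >> << l >>.
  by rewrite dotU starU.
by rewrite !dot_star; apply: ideal_pi0; left; exists m, n.
Qed.

(** The map induced by the identity; independent of the representative because
    [J'] is contained in [J]. *)
Definition Phi (u : calL' K deg) : calL K deg := piL (repr u).

Lemma Phi_piL' x : Phi (piL' x) = piL x.
Proof.
apply/eqP; rewrite -subr_eq0 -linearB; apply/eqP/piL_prelie_ideal.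
exact/pi_algE/pi_alg_repr.
Qed.

Lemma Phi_linear : linear Phi.
Proof.
move=> a u v; elim/pi_alg_ind: u => x; elim/pi_alg_ind: v => y.
rewrite -linearP; change (Phi (piL' (a *: x + y)) = a *: Phi (piL' x) + Phi (piL' y)).
by rewrite !Phi_piL' linearP.
Qed.

HB.instance Definition _ :=
  GRing.isLinear.Build K (calL' K deg) (calL K deg) *:%R Phi Phi_linear.

Lemma Phi_bijective : bijective Phi.
Proof.
(* The inverse is also induced by the identity, J being contained in J'. *)
have reprL x : piL' (repr (piL x)) = piL' x.
  apply/eqP; rewrite -subr_eq0 -linearB; apply/eqP/piL'_lie_ideal.
  exact/pi_algE/pi_alg_repr.
exists (fun v => piL' (repr v)); apply: pi_alg_ind => x.
  by rewrite [Phi _]Phi_piL' reprL.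
by rewrite [piL' _]reprL Phi_piL'.
Qed.

(** Both claims at once; the nonzero factor [c] is what lets the product of two
    monomials be recovered from either the pre-Lie product or the bracket. *)
Lemma unique_iso (opL' : {bilinear calL' K deg -> calL' K deg -> calL' K deg})
    (opL : {bilinear calL K deg -> calL K deg -> calL K deg})
    (c : magma E -> K) :
  (forall m, c m != 0) ->
  (forall m n, opL' (piL' << m >>) (piL' << n >>) = c m *: piL' << mag_mul m n >>) ->
  (forall m n, opL (piL << m >>) (piL << n >>) = c m *: piL << mag_mul m n >>) ->
  exists! F : calL' K deg -> calL K deg,
    alg_iso opL' opL F /\
    forall a : E, F (piL' << mag_gen a >>) = piL << mag_gen a >>.
Proof.
move=> c_neq0 hL' hL; exists Phi; split=> [|F0 [[F_lin _ FM] Fgen]].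
  split=> [|a]; last exact: Phi_piL'.
  split; [exact: Phi_linear | exact: Phi_bijective|].
  apply: pi_alg_ind => x; apply: pi_alg_ind => y.
  move: x y; apply: (malg_morph (p := piL') (f := Phi)) => m n.
  by rewrite hL' linearZ /= !Phi_piL' hL.
pose F : {linear calL' K deg -> calL K deg} :=
  HB.pack F0 (GRing.isLinear.Build _ _ _ _ F0 F_lin).
have F_mono m : F (piL' << m >>) = piL << m >>.
  elim: m => [//|m IHm n IHn]; apply: (scalerI (c_neq0 m)).
  by rewrite -linearZ -hL' [LHS]FM [F0 _]IHm [F0 _]IHn hL.
apply/funext; apply: pi_alg_ind => x; change (Phi (piL' x) = F (piL' x)).
elim/malg_lin_ind: x => [|a m x IHx]; first by rewrite !linear0.
rewrite !linearP /= IHx; congr (_ *: _ + _).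
exact: etrans (Phi_piL' _) (esym (F_mono m)).
Qed.

End Isomorphism.

Theorem corollary7 (K : fieldType) (char0 : [pchar K] =i pred0)
    (E : choiceType) (deg : E -> nat)
    (deg_gt0 : forall a : E, (0 < deg a)%N)
    (E_fin : forall n : nat, finite_set [set a : E | deg a = n])
    (E_nonempty : inhabited E) :
  (exists! Phi : calL' K deg -> calL K deg,
     alg_iso (@prelie_L' K E deg) (@prelie_L K E deg) Phi /\
     forall a : E, Phi (piL' deg << mag_gen a >>) = piL deg << mag_gen a >>)
  /\
  (exists! Phi : calL' K deg -> calL K deg,
     alg_iso (@lie_L' K E deg) (@lie_L K E deg) Phi /\
     forall a : E, Phi (piL' deg << mag_gen a >>) = piL deg << mag_gen a >>).
Proof.
have wt_neq0 := wt_neq0 char0 deg_gt0.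
split.
  apply: (unique_iso char0 deg_gt0 (c := fun=> 1)) => [m|m n|m n].
  - exact: oner_neq0.
  - by rewrite scale1r -dotU; apply: prelie_L'E.
  - by rewrite scale1r -dotU; rewrite [RHS]prelie_L_piL.
apply: (unique_iso char0 deg_gt0 wt_neq0) => m n.
- by rewrite -linearZ -starU; rewrite [RHS]lie_L'_piL'.
- by rewrite -linearZ -starU; apply: lie_LE.
Qed.
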